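(* (Algebraic FMP) $\mathbf{tHC}$ is sound and complete with respect to the class of finite temporal Heyting algebras.
   Context: Write $\mathsf{P}$ for the ''past diamond'' operator (black diamond). $\mathbf{mHC}$ is the smallest set of formulas in $\wedge,\vee,\to,\Box,\bot,\top$ containing intuitionistic propositional logic and $\Box(p\to q)\to(\Box p\to\Box q)$, $p\to\Box p$, $\Box p\to(q\vee(q\to p))$, closed under modus ponens and uniform substitution. $\mathbf{tHC}$ is the smallest set of formulas in the language extended with $\mathsf{P}$ containing $\mathbf{mHC}$ and $\mathsf{P}(p\vee q)\to(\mathsf{P}p\vee\mathsf{P}q)$, $\mathsf{P}\bot\to\bot$, $p\to\Box\mathsf{P}p$, $\mathsf{P}\Box p\to p$, closed under modus ponens, uniform substitution and the rule from $\varphi\to\chi$ infer $\mathsf{P}\varphi\to\mathsf{P}\chi$. A temporal Heyting algebra is a Heyting algebra with operators $\Box,\mathsf{P}$ such that $\Box(a\wedge b)=\Box a\wedge\Box b$, $a\le\Box a$, $\Box a\le b\vee(b\to a)$, and $\mathsf{P}a\le b\iff a\le\Box b$; a formula is valid in it if it evaluates to $1$ under every valuation. *)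

(* Defs.v *)
From HB Require Import structures.
From mathcomp Require Import all_boot all_order.

Set Implicit Arguments.
Unset Strict Implicit.
Unset Printing Implicit Defensive.

Declare Scope form_scope.
Delimit Scope form_scope with form.

Inductive form : Type :=
  | Var of nat
  | Bot
  | Top
  | And of form & form
  | Or of form & form
  | Imp of form & form
  | Box of form
  | Past of form.

Bind Scope form_scope with form.
Notation "p && q" := (And p q) : form_scope.
Notation "p || q" := (Or p q) : form_scope.
Notation "p ==> q" := (Imp p q) : form_scope.

Fixpoint past_free (f : form) : bool :=
  match f with
  | Var _ | Bot | Top => true
  | And f1 f2 | Or f1 f2 | Imp f1 f2 => (past_free f1 && past_free f2)%B
  | Box f1 => past_free f1
  | Past _ => false
  end.

Fixpoint modality_free (f : form) : bool :=
  match f with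
  | Var _ | Bot | Top => true
  | And f1 f2 | Or f1 f2 | Imp f1 f2 =>
      (modality_free f1 && modality_free f2)%B
  | Box _ | Past _ => false
  end.

Fixpoint subst (s : nat -> form) (f : form) : form :=
  match f with
  | Var n => s n
  | Bot => Bot
  | Top => Top
  | And f1 f2 => And (subst s f1) (subst s f2)
  | Or f1 f2 => Or (subst s f1) (subst s f2)
  | Imp f1 f2 => Imp (subst s f1) (subst s f2)
  | Box f1 => Box (subst s f1)
  | Past f1 => Past (subst s f1)
  end.

Local Notation p := (Var 0) (only parsing).
Local Notation q := (Var 1) (only parsing).
Local Notation r := (Var 2) (only parsing).

(* The three logics live in the nested languages {/\, \/, ->, bot, top}, that  *)
(* language with Box, and that language with Box and Past.  All are carved out *)
(* of [form]: the substitutions allowed in [IPC] and [mHC] take values in the  *)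
(* respective sublanguage, so every member of [IPC] (resp. [mHC]) is           *)
(* [modality_free] (resp. [past_free]).                                        *)
Inductive IPC : form -> Prop :=
  | IPC_K : IPC (p ==> (q ==> p))
  | IPC_S : IPC ((p ==> (q ==> r)) ==> ((p ==> q) ==> (p ==> r)))
  | IPC_andl : IPC ((p && q) ==> p)
  | IPC_andr : IPC ((p && q) ==> q)
  | IPC_andI : IPC (p ==> (q ==> (p && q)))
  | IPC_orl : IPC (p ==> (p || q))
  | IPC_orr : IPC (q ==> (p || q))
  | IPC_orE : IPC ((p ==> r) ==> ((q ==> r) ==> ((p || q) ==> r)))
  | IPC_bot : IPC (Bot ==> p)
  | IPC_top : IPC Top
  | IPC_mp f g : IPC f -> IPC (f ==> g) -> IPC g
  | IPC_subst s f :
      (forall n, modality_free (s n)) -> IPC f -> IPC (subst s f).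

Inductive mHC : form -> Prop :=
  | mHC_IPC f : IPC f -> mHC f
  | mHC_K : mHC (Box (p ==> q) ==> (Box p ==> Box q))
  | mHC_unit : mHC (p ==> Box p)
  | mHC_deriv : mHC (Box p ==> (q || (q ==> p)))
  | mHC_mp f g : mHC f -> mHC (f ==> g) -> mHC g
  | mHC_subst s f : (forall n, past_free (s n)) -> mHC f -> mHC (subst s f).

Inductive tHC : form -> Prop :=
  | tHC_mHC f : mHC f -> tHC f
  | tHC_past_or : tHC (Past (p || q) ==> (Past p || Past q))
  | tHC_past_bot : tHC (Past Bot ==> Bot)
  | tHC_box_past : tHC (p ==> Box (Past p))
  | tHC_past_box : tHC (Past (Box p) ==> p)
  | tHC_mp f g : tHC f -> tHC (f ==> g) -> tHC g
  | tHC_subst s f : tHC f -> tHC (subst s f)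
  | tHC_past_mono f g : tHC (f ==> g) -> tHC (Past f ==> Past g).

Local Open Scope order_scope.

HB.mixin Record TBLattice_isHeyting (d : Order.disp_t) T
    of Order.TBLattice d T := {
  himp : T -> T -> T;
  le_himp : forall a b c : T, (c <= himp a b) = (c `&` a <= b)
}.

#[short(type="heytingType")]
HB.structure Definition Heyting (d : Order.disp_t) :=
  {T of TBLattice_isHeyting d T & Order.TBLattice d T}.

HB.mixin Record Heyting_isTemporal (d : Order.disp_t) T of Heyting d T := {
  hbox : T -> T;
  hpast : T -> T;
  hboxI : forall a b : T, hbox (a `&` b) = hbox a `&` hbox b;
  le_hbox : forall a : T, a <= hbox a;
  hbox_le : forall a b : T, hbox a <= b `|` himp b a;
  hpast_adj : forall a b : T, hpast a <= b <-> a <= hbox b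
}.

#[short(type="temporalHeytingType")]
HB.structure Definition TemporalHeyting (d : Order.disp_t) :=
  {T of Heyting_isTemporal d T & Heyting d T}.

#[short(type="finHeytingType")]
HB.structure Definition FinHeyting (d : Order.disp_t) :=
  {T of Finite T & Heyting d T}.

#[short(type="finTemporalHeytingType")]
HB.structure Definition FinTemporalHeyting (d : Order.disp_t) :=
  {T of Finite T & TemporalHeyting d T}.

Fixpoint eval (d : Order.disp_t) (A : temporalHeytingType d) (v : nat -> A)
    (f : form) : A :=
  match f with
  | Var n => v n
  | Bot => \bot
  | Top => \top
  | And f1 f2 => eval v f1 `&` eval v f2
  | Or f1 f2 => eval v f1 `|` eval v f2
  | Imp f1 f2 => himp (eval v f1) (eval v f2)
  | Box f1 => hbox (eval v f1)
  | Past f1 => hpast (eval v f1)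
  end.

Definition valid (d : Order.disp_t) (A : temporalHeytingType d) (f : form) :
    Prop :=
  forall v : nat -> A, eval v f = \top.

(* Main.v *)
Require Import Defs.
From HB Require Import structures.
From mathcomp Require Import all_boot all_order.
From mathcomp Require Import boolp.

(** Soundness is a direct check.  For completeness, observe first that for any
    transitive relation [R] on a finite set the [R]-closed subsets form a
    temporal Heyting algebra, implication being computed with the reflexive
    closure of [R], and [Box], [Past] with [R] itself.  If [f] is not a theorem,
    take as points the subsets of the finite set [s] of subformulas of [f] whose
    generated filter is disjoint from the ideal generated by their complement
    in [s], and let [x R y] hold when [x] is included in [y], [Box g] in [x]
    forces [g] in [y], and [g] in [x] forces [Past g] in [y].  The axiom
    [Box p -> q \/ (q -> p)] makes the truth lemma hold for implication: if
    neither [a] nor [a -> b] is in [x], then [a] does not yield [b] from the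
    requirements that [x] puts on its [R]-successors, since otherwise
    [x] would prove [Box (a -> b)], hence [a \/ (a -> b)]. *)

Set Implicit Arguments.
Unset Strict Implicit.
Unset Printing Implicit Defensive.

Import Order.TTheory.
Local Open Scope order_scope.

(** * Soundness *)

Lemma himp_eq1 d (A : heytingType d) (a b : A) :
  (himp a b == \top) = (a <= b).
Proof. by rewrite -le1x le_himp meet1x. Qed.

Lemma himp_mp d (A : heytingType d) (a b : A) : himp a b `&` a <= b.
Proof. by rewrite -le_himp. Qed.

Lemma eval_subst d (A : temporalHeytingType d) (v : nat -> A) s f :
  eval v (subst s f) = eval (fun n => eval v (s n)) f.
Proof.
by elim: f => //= [f -> g ->|f -> g ->|f -> g ->|f ->|f ->].
Qed.

Lemma valid_mp d (A : temporalHeytingType d) f g :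
  valid A f -> valid A (Imp f g) -> valid A g.
Proof.
move=> vf vfg v; apply/eqP; rewrite -le1x -(vf v) -himp_eq1.
exact/eqP/vfg.
Qed.

Lemma valid_subst d (A : temporalHeytingType d) s f :
  valid A f -> valid A (subst s f).
Proof. by move=> vf v; rewrite eval_subst vf. Qed.

Lemma valid_imp d (A : temporalHeytingType d) f g :
  (forall v : nat -> A, eval v f <= eval v g) -> valid A (Imp f g).
Proof. by move=> le_fg v; apply/eqP; rewrite /= himp_eq1. Qed.

Lemma valid_IPC d (A : temporalHeytingType d) f : IPC f -> valid A f.
Proof.
elim=> {f} [||||||||||f g _ vf _|s f _ _]; last 2 first.
- exact: valid_mp.
- exact: valid_subst.
- by apply: valid_imp => v /=; rewrite le_himp leIl.
- apply: valid_imp => v /=; rewrite !le_himp.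
  set p := v 0; set q := v 1; set r := v 2.
  have le_qr : himp p (himp q r) `&` himp p q `&` p <= himp q r `&` q.
    by rewrite lexI -[X in X && _]le_himp -[X in _ && X]le_himp leIl leIr.
  exact: le_trans le_qr (himp_mp q r).
- by apply: valid_imp => v /=; rewrite leIl.
- by apply: valid_imp => v /=; rewrite leIr.
- by apply: valid_imp => v /=; rewrite le_himp.
- by apply: valid_imp => v /=; rewrite leUl.
- by apply: valid_imp => v /=; rewrite leUr.
- apply: valid_imp => v /=; rewrite !le_himp.
  set p := v 0; set q := v 1; set r := v 2.
  (* Residuation isolates the disjunction on the left, where it splits into one inequality per
     disjunct. *)
  rewrite meetC -le_himp leUx !le_himp; apply/andP; split.
    by apply: le_trans (himp_mp p r); rewrite meetC leI2 ?leIl.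
  by apply: le_trans (himp_mp q r); rewrite meetC leI2 ?leIr.
- by apply: valid_imp => v /=; rewrite le0x.
- by [].
Qed.

Lemma hbox_mono d (A : temporalHeytingType d) (a b : A) :
  a <= b -> hbox a <= hbox b.
Proof. by move=> /meet_idPl eq_a; rewrite leEmeet -hboxI eq_a. Qed.

Lemma valid_mHC d (A : temporalHeytingType d) f : mHC f -> valid A f.
Proof.
elim=> {f} [f||||f g _ vf _|s f _ _].
- exact: valid_IPC.
- apply: valid_imp => v /=; rewrite le_himp -hboxI.
  exact/hbox_mono/himp_mp.
- by apply: valid_imp => v /=; apply: le_hbox.
- by apply: valid_imp => v /=; apply: hbox_le.
- exact: valid_mp.
- exact: valid_subst.
Qed.

(** Everything about [Past] comes from the adjunction [hpast_adj]. Its unit [a <= hbox (hpast a)],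
    proved first, together with monotonicity of [hbox] handles the disjunction axiom and the
    monotonicity rule. *)
Lemma valid_tHC d (A : temporalHeytingType d) f : tHC f -> valid A f.
Proof.
have le_bp (a : A) : a <= hbox (hpast a) by apply/hpast_adj.
elim=> {f} [f|||||f g _ vf _|s f _|f g _ vfg].
- exact: valid_mHC.
- apply: valid_imp => v /=; apply/hpast_adj; rewrite leUx.
  apply/andP; split; apply: le_trans (le_bp _) (hbox_mono _).
    exact: leUl.
  exact: leUr.
- by apply: valid_imp => v /=; apply/hpast_adj; rewrite le0x.
- by apply: valid_imp => v /=.
- by apply: valid_imp => v /=; apply/hpast_adj.
- exact: valid_mp.
- exact: valid_subst.
- apply: valid_imp => v /=; apply/hpast_adj; apply: le_trans (le_bp _).
  by rewrite -himp_eq1; apply/eqP/vfg.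
Qed.

(** * The algebra of closed sets of a transitive frame *)

(** A single relation carries both structures: the intuitionistic preorder is the reflexive closure
    of [tf_rel]. Reflexive and irreflexive points may coexist. *)
Record transFrame := TransFrame {
  tf_point :> finType;
  tf_rel : rel tf_point;
  tf_trans : transitive tf_rel }.

Arguments tf_rel {_}.

Definition rclosed (X : transFrame) (U : {set X}) : bool :=
  [forall x in U, forall y, tf_rel x y ==> (y \in U)].

Lemma rclosedP (X : transFrame) (U : {set X}) :
  reflect (forall x y, tf_rel x y -> x \in U -> y \in U) (rclosed U).
Proof.
apply: (iffP forallP) => [cU x y xy xU | cU x].
  by move/implyP/(_ xU)/forallP/(_ y)/implyP: (cU x); apply.
by apply/implyP => xU; apply/forallP => y; apply/implyP => xy; apply: cU xy xU.
Qed.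

Record cset (X : transFrame) := CSet {
  cset_val :> {set X};
  csetP : rclosed cset_val }.

HB.instance Definition _ X := [isSub for @cset_val X].
HB.instance Definition _ X := [Finite of cset X by <:].

Lemma cset_closed (X : transFrame) (U : cset X) x y :
  tf_rel x y -> x \in (U : {set X}) -> y \in (U : {set X}).
Proof. exact: (rclosedP _ (csetP U)). Qed.

Definition cset_le X (U V : cset X) := (U : {set X}) \subset V.

Lemma cset_le_refl X : reflexive (@cset_le X).
Proof. by move=> U; apply: subxx. Qed.

Lemma cset_le_anti X : antisymmetric (@cset_le X).
Proof. by move=> U V; rewrite /cset_le -eqEsubset => /eqP/val_inj. Qed.

Lemma cset_le_trans X : transitive (@cset_le X).
Proof. by move=> V U W; apply: subset_trans. Qed.

Fact cset_display : Order.disp_t. Proof. exact: Order.Disp tt tt. Qed.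

HB.instance Definition _ X := Order.Le_isPOrder.Build cset_display (cset X)
  (@cset_le_refl X) (@cset_le_anti X) (@cset_le_trans X).

Lemma rclosedI X (U V : cset X) : rclosed ((U : {set X}) :&: V).
Proof.
apply/rclosedP => x y xy; rewrite !inE => /andP[xU xV].
by rewrite (cset_closed xy xU) (cset_closed xy xV).
Qed.

Lemma rclosedU X (U V : cset X) : rclosed ((U : {set X}) :|: V).
Proof.
apply/rclosedP => x y xy; rewrite !inE => /orP[xU|xV].
  by rewrite (cset_closed xy xU).
by rewrite (cset_closed xy xV) orbT.
Qed.

Definition csetI X (U V : cset X) := CSet (rclosedI U V).
Definition csetU X (U V : cset X) := CSet (rclosedU U V).

Lemma csetI_meet X (U V W : cset X) :
  (U <= csetI V W) = (U <= V) && (U <= W).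
Proof. exact: subsetI. Qed.

Lemma csetU_join X (U V W : cset X) :
  (csetU U V <= W) = (U <= W) && (V <= W).
Proof. exact: subUset. Qed.

HB.instance Definition _ X :=
  Order.POrder_MeetJoin_isLattice.Build cset_display (cset X)
    (@csetI_meet X) (@csetU_join X).

Lemma rclosed0 (X : transFrame) : rclosed (set0 : {set X}).
Proof. by apply/rclosedP => x y _; rewrite inE. Qed.

Lemma rclosedT (X : transFrame) : rclosed [set: X].
Proof. by apply/rclosedP => x y _; rewrite !inE. Qed.

Lemma cset0_le X (U : cset X) : CSet (rclosed0 X) <= U.
Proof. exact: sub0set. Qed.

Lemma csetT_ge X (U : cset X) : U <= CSet (rclosedT X).
Proof. exact: subsetT. Qed.

HB.instance Definition _ X :=
  Order.hasBottom.Build cset_display (cset X) (@cset0_le X).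
HB.instance Definition _ X :=
  Order.hasTop.Build cset_display (cset X) (@csetT_ge X).

Definition imp_set X (U V : cset X) : {set X} :=
  [set x | [forall y, ((x == y) || tf_rel x y) ==> (y \in (U : {set X})) ==>
                      (y \in (V : {set X}))]].

Lemma imp_setP X (U V : cset X) x :
  reflect (forall y, x = y \/ tf_rel x y -> y \in (U : {set X}) ->
                     y \in (V : {set X}))
          (x \in imp_set U V).
Proof.
rewrite inE; apply: (iffP forallP) => [h y xy yU | h y].
  move/implyP: (h y) => /(_ _)/implyP; apply=> //.
  by case: xy => [->|->]; rewrite ?eqxx ?orbT.
apply/implyP => xy; apply/implyP; apply: h.
by case/orP: xy => [/eqP|]; [left|right].
Qed.

Lemma rclosed_imp X (U V : cset X) : rclosed (imp_set U V).
Proof.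
apply/rclosedP => x y xy /imp_setP h; apply/imp_setP => z yz; apply: h; right.
by case: yz => [<- //|]; apply: tf_trans xy.
Qed.

Definition cset_imp X (U V : cset X) := CSet (rclosed_imp U V).

Lemma le_cset_imp X (U V W : cset X) :
  (W <= cset_imp U V) = (W `&` U <= V).
Proof.
apply/subsetP/subsetP => [h x | h x xW].
  by rewrite inE => /andP[/h/imp_setP + xU]; apply; first by left.
apply/imp_setP => y xy yU; apply: h; rewrite inE yU andbT.
by case: xy => [<- //|xy]; apply: cset_closed xy xW.
Qed.

HB.instance Definition _ X :=
  TBLattice_isHeyting.Build cset_display (cset X) (@le_cset_imp X).

Definition box_set X (U : cset X) : {set X} :=
  [set x | [forall y, tf_rel x y ==> (y \in (U : {set X}))]].

Lemma box_setP X (U : cset X) x :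
  reflect (forall y, tf_rel x y -> y \in (U : {set X})) (x \in box_set U).
Proof. by rewrite inE; apply: (iffP forallP) => h y; apply/implyP/h. Qed.

Lemma rclosed_box X (U : cset X) : rclosed (box_set U).
Proof.
apply/rclosedP => x y xy /box_setP h; apply/box_setP => z yz.
exact/h/(tf_trans xy).
Qed.

Definition cset_box X (U : cset X) := CSet (rclosed_box U).

Definition past_set X (U : cset X) : {set X} :=
  [set y | [exists x in (U : {set X}), tf_rel x y]].

Lemma past_setP X (U : cset X) y :
  reflect (exists2 x, x \in (U : {set X}) & tf_rel x y) (y \in past_set U).
Proof. by rewrite inE; apply: exists_inP. Qed.

Lemma rclosed_past X (U : cset X) : rclosed (past_set U).
Proof.
apply/rclosedP => x y xy /past_setP[z zU zx]; apply/past_setP.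
by exists z => //; apply: tf_trans xy.
Qed.

Definition cset_past X (U : cset X) := CSet (rclosed_past U).

Lemma cset_boxI X (U V : cset X) :
  cset_box (U `&` V) = cset_box U `&` cset_box V.
Proof.
apply/val_inj/setP => x; rewrite [RHS]inE.
apply/box_setP/andP => [h | [/box_setP hU /box_setP hV] y xy].
  by split; apply/box_setP => y /h; rewrite inE => /andP[].
by rewrite inE hU ?hV.
Qed.

Lemma le_cset_box X (U : cset X) : U <= cset_box U.
Proof. by apply/subsetP => x xU; apply/box_setP => y /cset_closed; apply. Qed.

(** At a point outside [V] the implication holds vacuously at the point itself; every other point
    that it inspects is a [tf_rel]-successor, where [Box] supplies [U]. *)
Lemma cset_box_le X (U V : cset X) : cset_box U <= V `|` himp V U.
Proof.
apply/subsetP => x /box_setP h; rewrite inE; case: (boolP (x \in _)) => //= xV.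
apply/imp_setP => y [<- /(negP xV) //|xy _]; exact: h.
Qed.

Lemma cset_past_adj X (U V : cset X) : cset_past U <= V <-> U <= cset_box V.
Proof.
split=> /subsetP h; apply/subsetP => x.
  by move=> xU; apply/box_setP => y xy; apply/h/past_setP; exists x.
by case/past_setP => y /h/box_setP; apply.
Qed.

HB.instance Definition _ X := Heyting_isTemporal.Build cset_display (cset X)
  (@cset_boxI X) (@le_cset_box X) (@cset_box_le X) (@cset_past_adj X).

(** * Derivations *)

Local Close Scope order_scope.
Local Open Scope form_scope.

(** The axioms are written in the first three variables; all later variables are sent to [Bot]. *)
Definition inst3 (a b c : form) (n : nat) : form := nth Bot [:: a; b; c] n.

Lemma tHC_inst a b c f : tHC f -> tHC (subst (inst3 a b c) f).
Proof. exact: tHC_subst. Qed.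

(** The substitution takes place in [tHC], where it is unrestricted: [a], [b], [c] may contain
    modalities, which the substitution rule of [IPC] forbids. *)
Lemma tHC_ipc a b c f : IPC f -> tHC (subst (inst3 a b c) f).
Proof. by move=> pf; apply/tHC_inst/tHC_mHC/mHC_IPC. Qed.

Lemma tHC_const a b : tHC (a ==> (b ==> a)).
Proof. exact: (tHC_ipc a b Bot IPC_K). Qed.

Lemma tHC_distr a b c : tHC ((a ==> (b ==> c)) ==> ((a ==> b) ==> (a ==> c))).
Proof. exact: (tHC_ipc a b c IPC_S). Qed.

(** Derivability from assumptions with modus ponens as the only rule. Substitution and monotonicity
    of [Past] act on theorems alone, which keeps the deduction theorem true. *)
Inductive filter_gen (G : form -> Prop) : form -> Prop :=
  | filter_mem g : G g -> filter_gen G g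
  | filter_thm g : tHC g -> filter_gen G g
  | filter_mp g h : filter_gen G g -> filter_gen G (g ==> h) -> filter_gen G h.

(** The dual notion: formulas that provably imply a finite disjunction of members of [M]. *)
Inductive ideal_gen (M : form -> Prop) : form -> Prop :=
  | ideal_mem g : M g -> ideal_gen M g
  | ideal_bot : ideal_gen M Bot
  | ideal_or g h : ideal_gen M g -> ideal_gen M h -> ideal_gen M (g || h)
  | ideal_le g h : tHC (g ==> h) -> ideal_gen M h -> ideal_gen M g.

Lemma filter_app G a b : tHC (a ==> b) -> filter_gen G a -> filter_gen G b.
Proof. by move=> ab Ga; apply: filter_mp Ga (filter_thm _ ab). Qed.

Lemma filter_trans G D g :
  filter_gen G g -> (forall c, G c -> filter_gen D c) -> filter_gen D g.
Proof.
move=> Gg GD; elim: Gg => {g} [//|g|g h _ Dg _].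
- exact: filter_thm.
- exact: filter_mp.
Qed.

Lemma filter_deduction G a b :
  filter_gen (fun g => G g \/ g = a) b -> filter_gen G (a ==> b).
Proof.
elim=> {b} [g [Gg|->]|g pg|g h _ Gg _ Ggh].
- exact: filter_app (tHC_const _ _) (filter_mem Gg).
(* The usual derivation of [a ==> a] from the axioms K and S. *)
- apply/filter_thm/(tHC_mp (tHC_const a a)).
  exact: tHC_mp (tHC_const a (a ==> a)) (tHC_distr _ _ _).
- exact: filter_app (tHC_const _ _) (filter_thm _ pg).
- exact: filter_mp Gg (filter_app (tHC_distr _ _ _) Ggh).
Qed.

Lemma filter_empty G g :
  (forall c, ~ G c) -> filter_gen G g -> tHC g.
Proof. by move=> G0; elim=> {g} [g /G0|//|g h _ + _]; last exact: tHC_mp. Qed.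

(** This lets later implications be proved by reasoning from one assumption rather than with
    combinators. *)
Lemma filter_principal a b : filter_gen (eq^~ a) b -> tHC (a ==> b).
Proof.
move=> ab; apply: (@filter_empty (fun _ => False)); first by move=> c [].
by apply: filter_deduction; apply: filter_trans ab _ => c ->;
   apply: filter_mem; right.
Qed.

Lemma tHC_refl a : tHC (a ==> a).
Proof. exact: filter_principal (filter_mem _). Qed.

Lemma tHC_trans a b c : tHC (a ==> b) -> tHC (b ==> c) -> tHC (a ==> c).
Proof.
move=> ab bc; apply: filter_principal; apply: filter_app bc _.
exact: filter_app ab (filter_mem _).
Qed.

Lemma tHC_orl a b : tHC (a ==> (a || b)).
Proof. exact: (tHC_ipc a b Bot IPC_orl). Qed.

Lemma tHC_orr a b : tHC (b ==> (a || b)).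
Proof. exact: (tHC_ipc a b Bot IPC_orr). Qed.

Lemma filter_orE G a b c :
  filter_gen G (a ==> c) -> filter_gen G (b ==> c) -> filter_gen G (a || b) ->
  filter_gen G c.
Proof.
move=> ac bc /filter_mp; apply; apply: filter_mp bc _.
exact: filter_app (tHC_ipc a b c IPC_orE) ac.
Qed.

Lemma tHC_orE a b c : tHC (a ==> c) -> tHC (b ==> c) -> tHC ((a || b) ==> c).
Proof.
move=> ac bc; apply: filter_principal.
apply: (@filter_orE _ a b); last exact: filter_mem.
- exact: filter_thm.
- exact: filter_thm.
Qed.

Lemma tHC_orS a b c d :
  tHC (a ==> c) -> tHC (b ==> d) -> tHC ((a || b) ==> (c || d)).
Proof.
move=> ac bd; apply: tHC_orE.
- exact: tHC_trans ac (tHC_orl c d).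
- exact: tHC_trans bd (tHC_orr c d).
Qed.

Lemma ideal_principal a g : ideal_gen (eq^~ a) g -> tHC (g ==> a).
Proof.
elim=> {g} [g ->||g h _ ga _|g h gh _ ha].
- exact: tHC_refl.
- exact: (tHC_ipc a Bot Bot IPC_bot).
- exact: tHC_orE.
- exact: tHC_trans gh ha.
Qed.

Lemma tHC_unit a : tHC (a ==> Box a).
Proof. exact: (tHC_inst a Bot Bot (tHC_mHC mHC_unit)). Qed.

Lemma tHC_boxK a b : tHC (Box (a ==> b) ==> (Box a ==> Box b)).
Proof. exact: (tHC_inst a b Bot (tHC_mHC mHC_K)). Qed.

Lemma tHC_box_or a b : tHC (Box a ==> (b || (b ==> a))).
Proof. exact: (tHC_inst a b Bot (tHC_mHC mHC_deriv)). Qed.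

Lemma tHC_unit_past a : tHC (a ==> Box (Past a)).
Proof. exact: (tHC_inst a Bot Bot tHC_box_past). Qed.

Lemma tHC_counit a : tHC (Past (Box a) ==> a).
Proof. exact: (tHC_inst a Bot Bot tHC_past_box). Qed.

Lemma tHC_pastU a b : tHC (Past (a || b) ==> (Past a || Past b)).
Proof. exact: (tHC_inst a b Bot tHC_past_or). Qed.

Lemma tHC_past_le a : tHC (Past a ==> a).
Proof. exact: tHC_trans (tHC_past_mono (tHC_unit a)) (tHC_counit a). Qed.

(** [Box] passes through derivations: theorems are boxed by [g ==> Box g], and modus ponens is boxed
    by the K axiom. *)
Lemma filter_box G D g :
  filter_gen G g -> (forall c, G c -> filter_gen D (Box c)) ->
  filter_gen D (Box g).
Proof.
move=> Gg GD; elim: Gg => {g} [//|g pg|g h _ Dg _ Dgh].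
- exact: filter_app (tHC_unit g) (filter_thm _ pg).
- exact: filter_mp Dg (filter_app (tHC_boxK _ _) Dgh).
Qed.

(** Dual of [filter_box]: [Past] respects falsum, disjunctions and provable implications, hence each
    clause of [ideal_gen]. *)
Lemma ideal_past M D g :
  ideal_gen M g -> (forall m, M m -> ideal_gen D (Past m)) ->
  ideal_gen D (Past g).
Proof.
move=> Mg MD; elim: Mg => {g} [//||g h _ Dg _ Dh|g h gh _ Dh].
- exact: ideal_le tHC_past_bot (ideal_bot D).
- exact: ideal_le (tHC_pastU g h) (ideal_or Dg Dh).
- exact: ideal_le (tHC_past_mono gh) Dh.
Qed.

(** Dual of the deduction theorem: all uses of [a] are gathered into one disjunct. *)
Lemma ideal_adjoin M a g :
  ideal_gen (fun m => M m \/ m = a) g ->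
  exists2 m, ideal_gen M m & tHC (g ==> (m || a)).
Proof.
elim=> {g} [g [Mg|->]||g h _ [m Mm gm] _ [n Mn hn]|g h gh _ [m Mm hm]].
- by exists g; [apply: ideal_mem | apply: tHC_orl].
- by exists Bot; [apply: ideal_bot | apply: tHC_orr].
- by exists Bot; [apply: ideal_bot | apply: tHC_orl].
- exists (m || n); first exact: ideal_or.
  apply: tHC_orE.
  + exact: tHC_trans gm (tHC_orS (tHC_orl m n) (tHC_refl a)).
  + exact: tHC_trans hn (tHC_orS (tHC_orr m n) (tHC_refl a)).
- by exists m => //; apply: tHC_trans gh hm.
Qed.

(** * Separated pairs and their extension over a finite list of formulas *)

Definition separated (G M : form -> Prop) : Prop :=
  forall g, filter_gen G g -> ~ ideal_gen M g.

(** This is cut. If both extensions fail, then [G] yields [a ==> g] and [m || a] with [g] and [m] in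
    the ideal of [M], hence [m || g], which lies in that ideal too. *)
Lemma separated_adjoin G M a : separated G M ->
  separated (fun g => G g \/ g = a) M \/ separated G (fun g => M g \/ g = a).
Proof.
move=> sGM; apply: contrapT => /not_orP[nl nr].
apply: nl => g /filter_deduction Gag Mg.
apply: nr => h Gh /ideal_adjoin[m Mm hm].
apply: (sGM (m || g)); last exact: ideal_or.
apply: (@filter_orE _ m a); last exact: filter_app hm Gh.
- exact: filter_thm (tHC_orl m g).
- apply: filter_deduction; apply: filter_app (tHC_orr m g) _.
  apply: (@filter_mp _ a); first by apply: filter_mem; right.
  by apply: filter_trans Gag _ => c Gc; apply: filter_mem; left.
Qed.

Lemma form_eq_dec : comparable form.
Proof.
by move=> f g; rewrite /decidable; decide equality; apply: eq_comparable.
Qed.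

HB.instance Definition _ := hasDecEq.Build form (compareP form_eq_dec).

(** A Lindenbaum lemma for finitely many formulas: the members of [s] are put on one side or the
    other, one at a time. *)
Lemma separated_decide (s : seq form) G M : separated G M ->
  exists G' M' : form -> Prop,
    [/\ forall g, G g -> G' g, forall g, M g -> M' g, separated G' M' &
        forall g, g \in s -> G' g \/ M' g].
Proof.
elim: s G M => [|a s IHs] G M sGM; first by exists G, M; split.
case: (separated_adjoin a sGM) => /IHs[G' [M' [GG' MM' sGM' dec]]];
  exists G', M'; split=> // g.
- by move=> Gg; apply: GG'; left.
- by rewrite inE => /orP[/eqP->|/dec//]; left; apply: GG'; right.
- by move=> Mg; apply: MM'; left.
- by rewrite inE => /orP[/eqP->|/dec//]; right; apply: MM'; right.
Qed.

(** * The finite canonical frame *)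

(** Sets of formulas are coded by sets of indices into [s], so that points form a [finType] although
    [form] is infinite. If [s] has repetitions, distinct index sets may have the same members. *)
Definition members (s : seq form) (S : {set 'I_(size s)}) : seq form :=
  [seq nth Bot s (i : 'I_(size s)) | i in S].

Lemma sub_members s (S : {set 'I_(size s)}) : {subset members S <= s}.
Proof. by move=> g /imageP[i _ ->]; apply: mem_nth. Qed.

(** A finite counterpart of a prime theory. Separation is turned into a boolean classically, as the
    subtype of points requires. *)
Definition is_point s (S : {set 'I_(size s)}) : bool :=
  `[< separated (fun g => g \in members S)
                (fun g => g \in s /\ g \notin members S) >].

Definition point s : finType := {S : {set 'I_(size s)} | is_point S}.

Definition theory s (x : point s) : seq form := members (val x).

Definition excluded s (x : point s) (g : form) : Prop :=
  g \in s /\ g \notin theory x.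

Lemma sub_theory s (x : point s) : {subset theory x <= s}.
Proof. exact: sub_members. Qed.

Lemma point_separated s (x : point s) :
  separated (fun g => g \in theory x) (excluded x).
Proof. exact: (asboolW (valP x)). Qed.

Lemma point_closed s (x : point s) g :
  g \in s -> filter_gen (fun h => h \in theory x) g -> g \in theory x.
Proof.
move=> sg xg; apply/negPn/negP => ng.
by apply: (point_separated xg); apply: ideal_mem.
Qed.

(** [G] and [M] may reach outside [s]. After every member of [s] is decided, the point keeps the
    indices of those on the [G] side. *)
Lemma point_extend s (G M : form -> Prop) : separated G M ->
  exists x : point s,
    (forall g, g \in s -> G g -> g \in theory x) /\
    (forall g, M g -> g \notin theory x).
Proof.
case/(separated_decide s) => G' [M' [GG' MM' sGM dec]].
pose S := [set i : 'I_(size s) | `[< G' (nth Bot s i) >]].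
have SG g : g \in members S -> G' g.
  by case/imageP => i; rewrite inE => /asboolP Gi ->.
have GS g : g \in s -> G' g -> g \in members S.
  move=> sg Gg; have lt_i : index g s < size s by rewrite index_mem.
  apply/imageP; exists (Ordinal lt_i); last by rewrite /= nth_index.
  by rewrite inE /= nth_index //; apply/asboolP.
(* Members of [s] outside [S] were decided into [M'], so a clash for [S] would be a clash between
   [G'] and [M']. *)
have pS : is_point S.
  apply/asboolP => g Sg Mg; apply: (sGM g).
    by apply: filter_trans Sg _ => c /SG/filter_mem.
  elim: Mg => {Sg g} [g [sg nSg]||g h _ Mg _ Mh|g h gh _ Mh].
  - by apply: ideal_mem; case: (dec g sg) => // /(GS g sg); rewrite (negPf nSg).
  - exact: ideal_bot.
  - exact: ideal_or.
  - exact: ideal_le gh Mh.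
exists (exist _ S pS); split=> g; first by move=> sg /GG'; apply: GS.
move=> Mg; apply/negP => /SG Gg.
exact: sGM (filter_mem Gg) (ideal_mem (MM' _ Mg)).
Qed.

Definition point_rel s (x y : point s) : bool :=
  [&& all (fun g => g \in theory y) (theory x),
      all (fun g => (Box g \in theory x) ==> (g \in theory y))%B s &
      all (fun g => (Past g \in s) ==> (Past g \in theory y))%B (theory x)].

Lemma point_relP s (x y : point s) :
  reflect [/\ forall g, g \in theory x -> g \in theory y,
              forall g, g \in s -> Box g \in theory x -> g \in theory y &
              forall g, Past g \in s -> g \in theory x -> Past g \in theory y]
          (point_rel x y).
Proof.
apply: (iffP and3P) => [[/allP le /allP bx /allP ps]|[le bx ps]].
  split=> // g sg xg; first exact: (implyP (bx g sg)).
  exact: (implyP (ps g xg)).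
by split; apply/allP => // g sg; apply/implyP => h; [apply: bx | apply: ps].
Qed.

Lemma point_rel_trans s : transitive (@point_rel s).
Proof.
move=> y x z /point_relP[xy bxy pxy] /point_relP[yz byz pyz]; apply/point_relP.
split=> g; first by move=> /xy/yz.
- by move=> sg /(bxy g sg)/yz.
- by move=> sg /xy/(pyz g sg).
Qed.

Definition canonical_frame s : transFrame := TransFrame (@point_rel_trans s).

(** * Existence of successors and predecessors of a point *)

Definition required_above s (x : point s) (g : form) : Prop :=
  [\/ g \in theory x, Box g \in theory x |
      exists2 e, e \in theory x & g = Past e].

(** Each requirement has its box derivable from [x], by [p ==> Box p], by membership or by
    [p ==> Box (Past p)]; [filter_box] extends this to all consequences. *)
Lemma required_above_box s (x : point s) g :
  filter_gen (required_above x) g ->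
  filter_gen (fun h => h \in theory x) (Box g).
Proof.
move/filter_box; apply=> c [xc|xc|[e xe ->]].
- exact: filter_app (tHC_unit c) (filter_mem xc).
- exact: filter_mem.
- exact: filter_app (tHC_unit_past e) (filter_mem xe).
Qed.

Lemma point_rel_required s (x y : point s) :
  (forall g, g \in s -> required_above x g -> g \in theory y) -> point_rel x y.
Proof.
move=> h; apply/point_relP; split=> g.
- by move=> xg; apply: h (sub_theory xg) _; apply: Or31.
- by move=> sg xg; apply: h => //; apply: Or32.
- by move=> sg xg; apply: h => //; apply: Or33; exists g.
Qed.

Lemma point_box s (x : point s) a : Box a \in s -> Box a \notin theory x ->
  exists2 y : point s, point_rel x y & a \notin theory y.
Proof.
move=> sa xa.
have /(point_extend s)[y [xy ay]] : separated (required_above x) (eq^~ a).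
  move=> g xg /ideal_principal ga; apply/negP: xa; rewrite negbK.
  apply: (point_closed sa); apply: required_above_box.
  exact: filter_app ga xg.
by exists y; [apply: point_rel_required | apply: ay].
Qed.

Lemma point_imp s (x : point s) a b :
  a \in s -> b \in s -> Imp a b \in s -> Imp a b \notin theory x ->
  exists y : point s,
    [/\ x = y \/ point_rel x y, a \in theory y & b \notin theory y].
Proof.
move=> sa sb sab xab.
(* If [a] is in [x], then [x] itself is the witness; otherwise a proper successor is built. *)
case: (boolP (a \in theory x)) => [xa|xa].
  exists x; split=> //; first by left.
  apply: contra xab => xb; apply: (point_closed sab).
  exact: filter_app (tHC_const b a) (filter_mem xb).
have /(point_extend s)[y [xy ay]] :
    separated (fun g => required_above x g \/ g = a) (eq^~ b).
  move=> g /filter_deduction xg /ideal_principal gb.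
  (* From [Box (a ==> g)] this gives [a || (a ==> (a ==> g))]. Contracting the repeated [a] and
     using [g ==> b] turns it into [a || (a ==> b)], both of whose disjuncts are excluded. *)
  have xbox := filter_app (tHC_box_or _ a) (required_above_box xg).
  apply: (point_separated (x := x) (g := a || (a ==> b))).
    apply: filter_app xbox; apply: (tHC_orS (tHC_refl a)).
    apply: filter_principal; apply: filter_deduction.
    have ha : filter_gen (fun h => h = (a ==> (a ==> g)) \/ h = a) a.
      by apply: filter_mem; right.
    apply: filter_app gb _; apply: (filter_mp ha); apply: (filter_mp ha).
    by apply: filter_mem; left.
  by apply: ideal_or; apply: ideal_mem.
exists y; split; last exact: ay.
- by right; apply: point_rel_required => g sg xg; apply: xy sg _; left.
- by apply: xy sa _; right.
Qed.

(** The mirror image of [required_above]: the contrapositives of the three clauses of [point_rel],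
    read at a predecessor of [y]. *)
Definition forbidden_below s (y : point s) (g : form) : Prop :=
  [\/ excluded y g, excluded y (Past g) |
      exists2 c, excluded y c & g = Box c].

Lemma forbidden_below_past s (y : point s) g :
  ideal_gen (forbidden_below y) g -> ideal_gen (excluded y) (Past g).
Proof.
move/ideal_past; apply=> m [ym|ym|[c yc ->]].
- exact: ideal_le (tHC_past_le m) (ideal_mem ym).
- exact: ideal_mem.
- exact: ideal_le (tHC_counit c) (ideal_mem yc).
Qed.

(** If [a] implied some [g] in the ideal of forbidden formulas, then [Past a] would imply [Past g],
    which lies in the ideal of formulas excluded from [y]. *)
Lemma point_past s (y : point s) a : a \in s -> Past a \in theory y ->
  exists2 x : point s, point_rel x y & a \in theory x.
Proof.
move=> sa ya.
have /(point_extend s)[x [ax xy]] : separated (eq^~ a) (forbidden_below y).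
  move=> g /filter_principal/tHC_past_mono ag /forbidden_below_past yg.
  exact: (point_separated (filter_mem ya) (ideal_le ag yg)).
exists x; last exact: ax.
apply/point_relP; split=> g.
- move=> xg; apply: contraLR (xg) => yg; apply: xy; apply: Or31.
  by split=> //; apply: sub_theory xg.
- by move=> sg; apply: contraLR => yg; apply: xy; apply: Or33; exists g.
- by move=> sg; apply: contraLR => yg; apply: xy; apply: Or32.
Qed.

(** * Completeness *)

Fixpoint subforms (f : form) : seq form :=
  f :: match f with
       | Var _ | Bot | Top => [::]
       | And g h | Or g h | Imp g h => subforms g ++ subforms h
       | Box g | Past g => subforms g
       end.

Lemma mem_subforms f : f \in subforms f.
Proof. by case: f => *; rewrite inE eqxx. Qed.

Lemma rclosed_var s n :
  rclosed [set x : canonical_frame s | Var n \in theory x].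
Proof.
by apply/rclosedP => x y /point_relP[xy _ _]; rewrite !inE; apply: xy.
Qed.

Definition canonical_val s (n : nat) : cset (canonical_frame s) :=
  CSet (rclosed_var s n).

(** The list [s] is fixed independently of [f], so the induction descends to subformulas within one
    frame. *)
Lemma truth s f (x : canonical_frame s) : {subset subforms f <= s} ->
  (x \in (eval (canonical_val s) f : {set canonical_frame s})) =
  (f \in theory x).
Proof.
elim: f x => [n|||f IHf g IHg|f IHf g IHg|f IHf g IHg|f IHf|f IHf] x sub /=;
  have sf := sub _ (mem_subforms _).
- by rewrite inE.
- rewrite inE; apply/esym/negP => xf.
  by apply: (point_separated (filter_mem xf)); apply: ideal_bot.
- rewrite inE; apply/esym/(point_closed sf)/filter_thm.
  exact: tHC_mHC (mHC_IPC IPC_top).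
- have subf : {subset subforms f <= s}.
    by move=> h hf; apply: sub; rewrite inE mem_cat hf orbT.
  have subg : {subset subforms g <= s}.
    by move=> h hg; apply: sub; rewrite inE mem_cat hg !orbT.
  rewrite inE IHf // IHg //; apply/andP/idP => [[xf xg]|xfg].
    apply: (point_closed sf); apply: filter_mp (filter_mem xg) _.
    exact: filter_app (tHC_ipc f g Bot IPC_andI) (filter_mem xf).
  split; apply: point_closed.
  + exact: subf (mem_subforms f).
  + exact: filter_app (tHC_ipc f g Bot IPC_andl) (filter_mem xfg).
  + exact: subg (mem_subforms g).
  + exact: filter_app (tHC_ipc f g Bot IPC_andr) (filter_mem xfg).
- have subf : {subset subforms f <= s}.
    by move=> h hf; apply: sub; rewrite inE mem_cat hf orbT.
  have subg : {subset subforms g <= s}.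
    by move=> h hg; apply: sub; rewrite inE mem_cat hg !orbT.
  rewrite inE IHf // IHg //; apply/orP/idP => [[xf|xg]|xfg].
  + exact: (point_closed sf (filter_app (tHC_orl f g) (filter_mem xf))).
  + exact: (point_closed sf (filter_app (tHC_orr f g) (filter_mem xg))).
  (* Primeness: two excluded disjuncts would put the disjunction into the ideal. *)
  + apply/orP/negPn/negP; rewrite negb_or => /andP[xf xg].
    apply: (point_separated (filter_mem xfg)).
    by apply: ideal_or; apply: ideal_mem; split=> //;
       [apply: subf | apply: subg]; apply: mem_subforms.
- have subf : {subset subforms f <= s}.
    by move=> h hf; apply: sub; rewrite inE mem_cat hf orbT.
  have subg : {subset subforms g <= s}.
    by move=> h hg; apply: sub; rewrite inE mem_cat hg !orbT.
  apply/(imp_setP (X := canonical_frame s))/idP => [h|xfg y xy].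
    apply/negPn/negP => xfg.
    have sf' := subf _ (mem_subforms f); have sg' := subg _ (mem_subforms g).
    have [y [xy yf yg]] := point_imp sf' sg' sf xfg.
    by case/negP: yg; rewrite -IHg //; apply: h xy _; rewrite IHf.
  rewrite IHf // IHg // => yf.
  apply: (point_closed (subg _ (mem_subforms g))).
  apply: filter_mp (filter_mem yf) _; apply: filter_mem.
  by case: xy => [<- //|/point_relP[+ _ _]]; apply.
- have subf : {subset subforms f <= s}.
    by move=> h hf; apply: sub; rewrite inE hf orbT.
  apply/(box_setP (X := canonical_frame s))/idP => [h|xf y /point_relP[_ xy _]].
    apply/negPn/negP => /(point_box sf)[y xy /negP].
    by rewrite -IHf //; apply; apply: h.
  by rewrite IHf //; apply: xy => //; apply: subf (mem_subforms f).
- have subf : {subset subforms f <= s}.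
    by move=> h hf; apply: sub; rewrite inE hf orbT.
  apply/(past_setP (X := canonical_frame s))/idP => [[y]|xf].
    by rewrite IHf // => yf /point_relP[_ _ yx]; apply: yx.
  have [y yx yf] := point_past (subf _ (mem_subforms f)) xf.
  by exists y; rewrite ?IHf.
Qed.

Lemma valid_complete f :
  (forall (d : Order.disp_t) (A : finTemporalHeytingType d), valid A f) ->
  tHC f.
Proof.
move=> vf; apply: contrapT => nf.
(* Separating no assumptions from [f] amounts to the unprovability of [f]; the resulting point
   refutes [f]. *)
have /(point_extend (subforms f))[x [_ xf]] :
    separated (fun _ => False) (eq^~ f).
  move=> g /filter_empty pg /ideal_principal gf; apply: nf.
  by apply: tHC_mp gf; apply: pg => c [].
case/negP: (xf f (erefl f)).
have /= vx := vf _ (cset (canonical_frame (subforms f))).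
by rewrite -(truth (s := subforms f)) // vx inE.
Qed.

Theorem theorem6p11 (f : form) :
  tHC f <-> forall (d : Order.disp_t) (A : finTemporalHeytingType d), valid A f.
Proof.
by split=> [pf d A|]; [apply: valid_tHC | apply: valid_complete].
Qed.
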